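(* Let $\mathcal{A}$ be an $n$-dimensional evolution algebra over a field $\mathbb{K}$ with natural basis $\{e_1,\dots,e_n\}$ and structure constants $w_{ki}$, and let $d_2$ and $d_3$ be linear maps on $\mathcal{A}$, with $d_\ell(e_i)=\sum_{k=1}^n d^{(\ell)}_{ki}e_k$ for $\ell=2,3$. Then the system $$w_{ki}d^{(2)}_{ij}+w_{kj}d^{(3)}_{ji}=0\quad\text{for all } k,i,j\in\{1,\dots,n\}\text{ with } i\ne j$$ holds if and only if the following conditions hold for all $i,j\in\{1,\dots,n\}$ with $i\neq j$: (i) if $e_i^2=c\,e_j^2$ for $c\neq0$, then $d^{(3)}_{ij},d^{(3)}_{ji}$ are free, with $d^{(2)}_{ij}=-c\,d^{(3)}_{ji}$ and $d^{(2)}_{ji}=-c^{-1}d^{(3)}_{ij}$; (ii) if $e_i^2=0$ and $e_j^2\neq0$, then $d^{(2)}_{ij}$ and $d^{(3)}_{ij}$ are free and $d^{(2)}_{ji}=d^{(3)}_{ji}=0$; (iii) if $e_i^2=e_j^2=0$, then $d^{(2)}_{ij},d^{(2)}_{ji},d^{(3)}_{ij}$ and $d^{(3)}_{ji}$ are free; (iv) if $e_i^2$ and $e_j^2$ are independent, then $d^{(2)}_{ij}=d^{(2)}_{ji}=d^{(3)}_{ij}=d^{(3)}_{ji}=0$.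
   Context: $\mathbb{K}$ is an arbitrary field. An $n$-dimensional evolution algebra is an $n$-dimensional vector space $\mathcal{A}$ over $\mathbb{K}$ with a bilinear product admitting a basis $\{e_1,\dots,e_n\}$ (a natural basis) such that $e_ie_j=0$ for $i\neq j$; the structure constants $w_{ki}\in\mathbb{K}$ are defined by $e_i^2=\sum_{k=1}^n w_{ki}e_k$. In (i), $c\in\mathbb{K}$. ''Independent'' means linearly independent over $\mathbb{K}$, and ''free'' means that the entry may take arbitrary values in $\mathbb{K}$.
   Formalization: In (i), c and c^{-1} are exchanged: d^{(2)}_{ij}=-c^{-1}d^{(3)}_{ji}, d^{(2)}_{ji}=-c d^{(3)}_{ij} (as printed it fails unless c^2=1, e.g. e_1^2=2e_1, e_2^2=e_1), and (i) is required only when e_j^2≠0, since it otherwise conflicts with (iii). *)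

(* Defs.v *)
From mathcomp Require Import all_boot all_algebra.

Set Implicit Arguments.
Unset Strict Implicit.
Unset Printing Implicit Defensive.

Import GRing.Theory.
Local Open Scope ring_scope.

(* Since e is an n-tuple, [basis_of {:A} e] forces \dim {:A} = n. *)
Definition natural_basis (K : fieldType) (A : vectType K)
    (mul : {bilinear A -> A -> A}) (n : nat) (e : n.-tuple A) : Prop :=
  basis_of {:A} e /\ (forall i j : 'I_n, i != j -> mul e`_i e`_j = 0).

Section Entries.

Variables (K : fieldType) (A : vectType K) (mul : {bilinear A -> A -> A}).
Variables (n : nat) (e : n.-tuple A).

Definition sq (i : 'I_n) : A := mul e`_i e`_i.

(* w_{ki}: coordinate of e_i^2 on e_k *)
Definition structure_constant (k i : 'I_n) : K := coord e k (sq i).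

(* d_{ki}: coordinate of d(e_i) on e_k, so columns are images *)
Definition entry (d : 'End(A)) (k i : 'I_n) : K := coord e k (d e`_i).

Definition offdiag_system (d2 d3 : 'End(A)) : Prop :=
  forall k i j : 'I_n, i != j ->
    structure_constant k i * entry d2 i j
      + structure_constant k j * entry d3 j i = 0.

(* The equations imposed at the pair (i, j), by the relative position of e_i^2
   and e_j^2. When e_i^2 = e_j^2 = 0 nothing is imposed, which is why the
   proportional case requires e_j^2 != 0: otherwise it would hold for every c.
   When e_i^2 = c e_j^2 != 0 the system reads
   (c d2_{ij} + d3_{ji}) e_j^2 = 0 = (d2_{ji} + c d3_{ij}) e_j^2,
   so c^-1 goes with d2_{ij} and c with d2_{ji}; exchanging c and c^-1 here
   would be wrong unless c^2 = 1. *)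
Definition pair_relations (d2 d3 : 'End(A)) (i j : 'I_n) : Prop :=
  [/\ forall c : K, c != 0 -> sq j != 0 -> sq i = c *: sq j ->
        entry d2 i j = - (c^-1 * entry d3 j i) /\
        entry d2 j i = - (c * entry d3 i j),
      sq i = 0 -> sq j != 0 -> entry d2 j i = 0 /\ entry d3 j i = 0
    & free [:: sq i; sq j] ->
        [/\ entry d2 i j = 0, entry d2 j i = 0,
            entry d3 i j = 0 & entry d3 j i = 0]].

(* The entries left free at the pair (i, j), i.e. those not determined by
   pair_relations, take the values prescribed by X2 (for d2) and X3 (for d3).
   In the proportional case d3_{ij}, d3_{ji} are taken as the parameters. *)
Definition free_entries_are (X2 X3 : 'M[K]_n) (d2 d3 : 'End(A))
    (i j : 'I_n) : Prop :=
  [/\ forall c : K, c != 0 -> sq j != 0 -> sq i = c *: sq j ->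
        entry d3 i j = X3 i j /\ entry d3 j i = X3 j i,
      sq i = 0 -> sq j != 0 ->
        entry d2 i j = X2 i j /\ entry d3 i j = X3 i j
    & sq i = 0 -> sq j = 0 ->
        [/\ entry d2 i j = X2 i j, entry d2 j i = X2 j i,
            entry d3 i j = X3 i j & entry d3 j i = X3 j i]].

End Entries.

(* Main.v *)
Require Import Defs.
From mathcomp Require Import all_boot all_algebra.
Local Open Scope ring_scope.

Import GRing.Theory.

(** Read over all [k] at once, the system at an ordered pair [(i, j)] is the
    single vector equation
    [d2_ij *: e_i^2 + d3_ji *: e_j^2 = 0] ([offdiag_systemP]), because the
    [w_ki] are the coordinates of [e_i^2].  So the coefficients
    [(d2_ij, d3_ji)] form a linear relation between two vectors, and the only
    thing that matters is whether these vectors vanish, are proportional, or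
    are independent.

    The equivalence with the pairwise conditions is this case analysis, made
    at both [(i, j)] and [(j, i)]: the conditions for [(i, j)] and [(j, i)]
    together cover every position of two vectors.

    For the freeness, distinct ordered pairs constrain disjoint sets of
    entries: [d2_ij] and [d3_ji] occur only in the equation at [(i, j)].  It is
    thus enough to solve [a *: u + b *: v = 0] with prescribed free
    coefficients one pair at a time ([exists_relation_prescribed]), and to
    note that any matrix is the matrix of an endomorphism
    ([exists_endo_entries]). *)

(** * Linear relations between two vectors *)

Section TwoVectors.

Variables (K : fieldType) (A : vectType K).
Implicit Types (u v : A) (a b c x y : K).

Lemma free2E u v : free [:: u; v] = (u \notin <[v]>%VS) && (v != 0).
Proof. by rewrite free_cons span_seq1 seq1_free. Qed.

Lemma free2_relation u v a b :
  free [:: u; v] -> a *: u + b *: v = 0 -> a = 0 /\ b = 0.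
Proof.
rewrite free2E => /andP[uNv v0] rel.
have a0 : a = 0.
  apply/eqP/contraT => a0; case/negP: uNv; apply/vlineP; exists (- (a^-1 * b)).
  by rewrite scaleNr -scalerA -(addr0_eq rel) scalerN opprK scalerK.
split=> //; move/eqP: rel.
by rewrite a0 scale0r add0r scaler_eq0 (negPf v0) orbF => /eqP.
Qed.

Lemma proportional_relation u v a b c :
  c != 0 -> v != 0 -> u = c *: v ->
  (a *: u + b *: v = 0) <-> a = - (c^-1 * b).
Proof.
move=> c0 v0 ->; rewrite scalerA -scalerDl; split=> [/eqP|->].
  rewrite scaler_eq0 (negPf v0) orbF addr_eq0 => /eqP acE.
  by rewrite -mulrN mulrC -[b]opprK -acE opprK mulfK.
by rewrite mulNr mulrAC mulVf // mul1r addNr scale0r.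
Qed.

(** The coefficient of [v] can be prescribed exactly when [v] is a multiple of
    [u], and the coefficient of [u] can be prescribed at least when [u]
    vanishes, independently of the other.  These two criteria say in one
    stroke what is free in all the positions of [u] and [v]. *)
Lemma exists_relation_prescribed u v x y :
  exists p : K * K,
    [/\ p.1 *: u + p.2 *: v = 0, u = 0 -> p.1 = x
      & v \in <[u]>%VS -> p.2 = y].
Proof.
have [/vlineP[c ->]|vNu] := boolP (v \in <[u]>%VS).
  exists (if u == 0 then x else - (y * c), y); split=> //= [|->].
    by have [->|_] := eqVneq u 0; rewrite ?scaler0 ?addr0 // scalerA -scalerDl
      addNr scale0r.
  by rewrite eqxx.
exists (if u == 0 then x else 0, 0); split=> //= [|->]; last by rewrite eqxx.
by rewrite scale0r addr0; case: eqVneq => [->|_]; rewrite ?scaler0 ?scale0r.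
Qed.

End TwoVectors.

Arguments free2_relation {K A u v a b}.
Arguments proportional_relation {K A u v a b c}.
Arguments exists_relation_prescribed {K A}.

(** * Coordinates in a natural basis *)

Section Coordinates.

Variables (K : fieldType) (A : vectType K) (n : nat) (e : n.-tuple A).
Hypothesis e_basis : basis_of {:A} e.

Lemma coord_eq0P (x : A) : x = 0 <-> forall k, coord e k x = 0.
Proof.
split=> [-> k|x0]; first by rewrite linear0.
rewrite (coord_basis e_basis (memvf x)) big1 // => k _.
by rewrite x0 scale0r.
Qed.

Lemma exists_endo_entries (M : 'M[K]_n) :
  exists d : 'End(A), forall i j, entry e d i j = M i j.
Proof.
pose img := [seq \sum_(i < n) M i j *: e`_i | j <- enum 'I_n].
have e_free := basis_free e_basis.
have [f fE] := linear_of_free e img.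
have size_img : size img = size e by rewrite size_map size_enum_ord size_tuple.
exists (linfun f) => i j; rewrite /entry lfunE /=.
have -> : f e`_j = \sum_(k < n) M k j *: e`_k.
  rewrite -(nth_map 0 0) ?size_tuple // (fE e_free size_img).
  by rewrite (nth_map j) ?size_enum_ord // nth_ord_enum.
by rewrite coord_sum_free.
Qed.

Variable mul : {bilinear A -> A -> A}.

Lemma offdiag_systemP (d2 d3 : 'End(A)) :
  offdiag_system mul e d2 d3 <->
  forall i j : 'I_n, i != j ->
    entry e d2 i j *: sq mul e i + entry e d3 j i *: sq mul e j = 0.
Proof.
have coordE k (i j : 'I_n) a b :
    coord e k (a *: sq mul e i + b *: sq mul e j) =
    structure_constant mul e k i * a + structure_constant mul e k j * b.
  by rewrite linearD !linearZ /= mulrC [b * _]mulrC.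
split=> [sys i j ij|sys k i j ij].
  by apply/coord_eq0P => k; rewrite coordE sys.
by rewrite -coordE sys // linear0.
Qed.

Lemma offdiag_system_pair_relations (d2 d3 : 'End(A)) :
  offdiag_system mul e d2 d3 <->
  (forall i j : 'I_n, i != j -> pair_relations mul e d2 d3 i j).
Proof.
apply: (iff_trans (offdiag_systemP d2 d3)); split=> [sys i j ij|rels i j ij].
  have relij := sys i j ij; have relji := sys j i.
  rewrite eq_sym in relji; move: {relji}(relji ij) => relji.
  split=> [c c0 v0 uE|u0 v0|uv_free].
  - split; first exact/(proportional_relation c0 v0 uE).
    apply/eqP; rewrite -addr_eq0; move/eqP: relji.
    by rewrite uE scalerA -scalerDl scaler_eq0 (negPf v0) orbF [c * _]mulrC.
  - move/eqP: relij; move/eqP: relji; rewrite u0 !scaler0 addr0 add0r.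
    by rewrite !scaler_eq0 (negPf v0) !orbF => /eqP-> /eqP->.
  - rewrite addrC in relji.
    have [-> ->] := free2_relation uv_free relij.
    by have [-> ->] := free2_relation uv_free relji.
have [prop zero indep] := rels i j ij.
have [_ zero' _] : pair_relations mul e d2 d3 j i by apply: rels; rewrite eq_sym.
have [v0|v0] := eqVneq (sq mul e j) 0.
  have [u0|u0] := eqVneq (sq mul e i) 0; first by rewrite u0 v0 !scaler0 addr0.
  by have [-> _] := zero' v0 u0; rewrite v0 scale0r scaler0 addr0.
have [/vlineP[c uE]|uNv] := boolP (sq mul e i \in <[sq mul e j]>%VS).
  have [c0|c0] := eqVneq c 0.
    have u0 : sq mul e i = 0 by rewrite uE c0 scale0r.
    by have [_ ->] := zero u0 v0; rewrite u0 scaler0 scale0r addr0.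
  by apply/(proportional_relation c0 v0 uE); case: (prop c c0 v0 uE).
have [|-> _ _ ->] := indep; first by rewrite free2E uNv.
by rewrite !scale0r addr0.
Qed.

Lemma exists_offdiag_system_prescribed (X2 X3 : 'M[K]_n) :
  exists d2 d3 : 'End(A),
    offdiag_system mul e d2 d3 /\
    (forall i j : 'I_n, i != j -> free_entries_are mul e X2 X3 d2 d3 i j).
Proof.
have [p pP] := fin_all_exists (fun ij : 'I_n * 'I_n =>
  exists_relation_prescribed (sq mul e ij.1) (sq mul e ij.2)
    (X2 ij.1 ij.2) (X3 ij.2 ij.1)).
have [d2 d2E] := exists_endo_entries (\matrix_(i, j) (p (i, j)).1).
(* The unknown paired with [d2_ij] is [d3_ji], hence the transposed index. *)
have [d3 d3E] := exists_endo_entries (\matrix_(i, j) (p (j, i)).2).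
have d2X i j : sq mul e i = 0 -> entry e d2 i j = X2 i j.
  by rewrite d2E mxE; case: (pP (i, j)).
have d3X i j : sq mul e i \in <[sq mul e j]>%VS -> entry e d3 i j = X3 i j.
  by rewrite d3E mxE; case: (pP (j, i)).
exists d2, d3; split=> [|i j _].
  by apply/offdiag_systemP => i j _; rewrite d2E d3E !mxE; case: (pP (i, j)).
split=> [c c0 _ uE|u0 _|u0 v0].
- split; apply: d3X; apply/vlineP; first by exists c.
  by exists c^-1; rewrite uE scalerK.
- by split; [apply: d2X | apply: d3X; rewrite u0 mem0v].
- by split; [apply: d2X | apply: d2X | apply: d3X | apply: d3X];
    rewrite ?u0 ?v0 ?mem0v.
Qed.

End Coordinates.

Theorem proposition4p2 (K : fieldType) (A : vectType K)
    (mul : {bilinear A -> A -> A}) (n : nat) (e : n.-tuple A)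
    (he : natural_basis mul e) :
  (forall d2 d3 : 'End(A),
     offdiag_system mul e d2 d3 <->
     (forall i j : 'I_n, i != j -> pair_relations mul e d2 d3 i j)) /\
  (forall X2 X3 : 'M[K]_n,
     exists d2 d3 : 'End(A),
       offdiag_system mul e d2 d3 /\
       (forall i j : 'I_n, i != j -> free_entries_are mul e X2 X3 d2 d3 i j)).
Proof.
have [e_basis _] := he; split.
  exact: offdiag_system_pair_relations.
exact: exists_offdiag_system_prescribed.
Qed.
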